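(* For every two natural numbers $n$ and $k$, every indexed set $Q$ of polynomials of degree at most $k$ with $n$ pairs of twin variables, and every two positive integers $s$ and $w$: if there is a Positivstellensatz (PS) refutation from $Q$ of product-width at most $w$ and monomial size at most $s$, then there is a PS refutation from $Q$ of product-width at most $w$ and degree at most $4\sqrt{2(n+1)\log(s)}+kw+4$.
   Context: $\log$ is the natural logarithm. $\mathbb{R}[x]$ is the ring of real polynomials in the $2n$ commuting variables $x_1,\ldots,x_n,\bar{x}_1,\ldots,\bar{x}_n$; each $x_i,\bar{x}_i$ is a pair of twin variables. $B_n=\{x_i^2-x_i,\ \bar{x}_i^2-\bar{x}_i,\ x_i+\bar{x}_i-1 : i\in[n]\}$ is the set of Boolean axioms, where $[n]=\{1,\ldots,n\}$. For a polynomial $p$, $\mathrm{size}(p)$ is the number of (nonzero) terms of $p$. The usual convention $\deg(0)=-\infty$ is used. An indexed set of polynomials $Q=\{q_1,\ldots,q_\ell,p_1,\ldots,p_m\}\subseteq\mathbb{R}[x]$ is interpreted as the constraints $q_1\geq 0,\ldots,q_\ell\geq 0$, $p_1=0,\ldots,p_m=0$. A PS proof of $p\geq 0$ from $Q$ is a formal polynomial identity $$p=s_\emptyset+\sum_{J\in\mathscr{J}}s_J\prod_{j\in J}q_j+\sum_{j\in[m]}t_jp_j+\sum_{q\in B_n}u_qq,$$ where $\mathscr{J}$ is a collection of non-empty subsets of $[\ell]$, each $s_J$ ($J\in\mathscr{J}\cup\{\emptyset\}$) is given as a sum of squares $s_J=\sum_{i=1}^{k_J}r_{i,J}^2$ of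 polynomials, and the $t_j,u_q$ are arbitrary polynomials. A PS refutation from $Q$ is a PS proof of $-1\geq 0$ from $Q$. The proof has degree at most $d$ if $\deg(p)\le d$, $\deg(s_\emptyset)\leq d$, $\deg(s_J)+\sum_{j\in J}\deg(q_j)\leq d$ for each $J\in\mathscr{J}$, and $\deg(t_j)+\deg(p_j)\leq d$ for each $j\in[m]$. It has monomial size at most $s$ if $\sum_{i}\mathrm{size}(r_{i,\emptyset})+\sum_{J\in\mathscr{J}}\sum_{i=1}^{k_J}\mathrm{size}(r_{i,J})+\sum_{j\in[m]}\mathrm{size}(t_j)\leq s$. It has product-width at most $w$ if each $J\in\mathscr{J}$ has cardinality at most $w$. (The $u_q$ do not count towards degree or size.) *)

(* Defs.v *)
(* Real numbers are an arbitrary [R : realType] of MathComp-Analysis;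
   multivariate polynomials come from the multinomials library. *)
From mathcomp Require Import all_boot all_order all_algebra.
From mathcomp Require Import reals constructive_ereal ereal exp.
From mathcomp Require mpoly.
(* The notations of mpoly.v clash with those of MathComp-Analysis. *)
Import -(notations) mpoly.
Set Implicit Arguments.
Unset Strict Implicit.
Unset Printing Implicit Defensive.
Import Order.TTheory GRing.Theory Num.Theory.
Local Open Scope ring_scope.

(* Among the n + n variables, index [lshift n i] is x_i and index [rshift n i]
   is its twin \bar x_i. *)
Notation twin_poly R n := (mpoly (n + n) R).

Definition var (R : realType) (n : nat) (i : 'I_n) : twin_poly R n :=
  mpolyX R (mnm1 (lshift n i)).

Definition twin (R : realType) (n : nat) (i : 'I_n) : twin_poly R n :=
  mpolyX R (mnm1 (rshift n i)).

(* The set B_n of Boolean axioms, indexed by three copies of 'I_n. *)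
Definition bool_axiom (R : realType) (n : nat) (b : 'I_n + 'I_n + 'I_n) :
    twin_poly R n :=
  match b with
  | inl (inl i) => var R i ^+ 2 - var R i
  | inl (inr i) => twin R i ^+ 2 - twin R i
  | inr i => var R i + twin R i - 1
  end.

(* Extended-real valued, so that deg 0 = -oo. *)
Definition deg (R : realType) (N : nat) (f : mpoly N R) : \bar R :=
  if f == 0 then -oo%E else ((msize f).-1%:R)%:E.

Definition nterms (R : realType) (N : nat) (f : mpoly N R) : nat :=
  size (msupp f).

Definition sum_sq (R : realType) (N : nat) (r : seq (mpoly N R)) : mpoly N R :=
  \sum_(f <- r) f ^+ 2.

(* Positivstellensatz proofs of f >= 0 from the constraints
   q_j >= 0 (j < l) and p_j = 0 (j < m).  [ps_sos pi J] lists the polynomials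
   r_{i,J} with s_J = \sum_i r_{i,J}^2; it is only relevant for J empty or in
   [ps_sets pi]. *)
Record ps_proof (R : realType) (n l m : nat) (q : 'I_l -> twin_poly R n)
    (p : 'I_m -> twin_poly R n) (f : twin_poly R n) := PSProof {
  ps_sets : {set {set 'I_l}};
  ps_sets_nonempty : set0 \notin ps_sets;
  ps_sos : {set 'I_l} -> seq (twin_poly R n);
  ps_eqs : 'I_m -> twin_poly R n;
  ps_bool : 'I_n + 'I_n + 'I_n -> twin_poly R n;
  ps_identity :
    f = sum_sq (ps_sos set0)
        + \sum_(J in ps_sets) sum_sq (ps_sos J) * \prod_(j in J) q j
        + \sum_(j < m) ps_eqs j * p j
        + \sum_b ps_bool b * bool_axiom R b
}.

Definition ps_refutation (R : realType) (n l m : nat)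
    (q : 'I_l -> twin_poly R n) (p : 'I_m -> twin_poly R n) : Type :=
  ps_proof q p (-1).

(* Multiples of the Boolean axioms count neither towards degree nor towards
   monomial size. *)
Definition ps_degree_le (R : realType) (n l m : nat)
    (q : 'I_l -> twin_poly R n) (p : 'I_m -> twin_poly R n)
    (f : twin_poly R n) (pi : ps_proof q p f) (d : R) : Prop :=
  [/\ (deg f <= d%:E)%E,
      (deg (sum_sq (ps_sos pi set0)) <= d%:E)%E,
      forall J : {set 'I_l}, J \in ps_sets pi ->
        (deg (sum_sq (ps_sos pi J)) + \sum_(j in J) deg (q j) <= d%:E)%E
    & forall j : 'I_m, (deg (ps_eqs pi j) + deg (p j) <= d%:E)%E].

Definition ps_size (R : realType) (n l m : nat)
    (q : 'I_l -> twin_poly R n) (p : 'I_m -> twin_poly R n)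
    (f : twin_poly R n) (pi : ps_proof q p f) : nat :=
  (\sum_(r <- ps_sos pi set0) nterms r
   + \sum_(J in ps_sets pi) \sum_(r <- ps_sos pi J) nterms r
   + \sum_(j < m) nterms (ps_eqs pi j))%N.

Definition ps_width_le (R : realType) (n l m : nat)
    (q : 'I_l -> twin_poly R n) (p : 'I_m -> twin_poly R n)
    (f : twin_poly R n) (pi : ps_proof q p f) (w : nat) : Prop :=
  forall J : {set 'I_l}, J \in ps_sets pi -> (#|J| <= w)%N.

(* Main.v *)
(* Modulo the Boolean axioms a polynomial is a real function on {0,1}^n, so
   proofs are studied as identities between such functions.  Let y be a literal.
   A refutation of half-degree e of the constraints restricted to y = 1,
   multiplied by y = y^2, proves -y >= 0 in half-degree e + 1.  The restriction
   to y = 0 changes a function G by a multiple of y, and completing the square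
   bounds y G by an arbitrarily small constant plus a multiple of y; so, given
   -y >= 0, a refutation under y = 0 lifts to a refutation of the unrestricted
   constraints with no loss of degree.

   Call a monomial wide if it has at least d distinct literals.  Some literal
   occurs in a fraction d / 2n of the wide monomials; setting it to 0 kills
   these at the cost of one unit of half-degree, and setting it to 1 costs
   nothing.  With d about sqrt(2(n+1) log s), d such steps kill all wide
   monomials, and a refutation without wide monomials has low degree. *)
Require Import Defs.
From mathcomp Require Import all_boot all_order all_algebra.
From mathcomp Require Import reals constructive_ereal ereal sequences exp.
From mathcomp Require mpoly.
From mathcomp Require Import ring lra zify.
Import -(notations) mpoly.
Set Implicit Arguments.
Unset Strict Implicit.
Unset Printing Implicit Defensive.
Import Order.TTheory GRing.Theory Num.Theory.
Local Open Scope ring_scope.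

(** * Literals, monomials and assignments on the Boolean cube *)

Definition cube (n : nat) := {ffun 'I_n -> bool}.

Section Literals.
Variable n : nat.
Implicit Types (u v : 'I_(n + n)) (a : cube n) (A B : {set 'I_(n + n)}).

Definition lit_val a v : bool :=
  match split v with inl i => a i | inr i => ~~ a i end.

Definition lit_neg v : 'I_(n + n) :=
  match split v with inl i => rshift n i | inr i => lshift n i end.

(** Exponents do not matter on 0/1 points, so a set of literals stands for the product of its
    members. *)
Definition mon A a : bool := [forall v in A, lit_val a v].

(** Restrictions are substitutions [F (assign v a)]: restricted functions stay on the same cube and
    [n] never changes. *)
Definition assign v a : cube n :=
  [ffun j => match split v with
             | inl i => (j == i) || a j
             | inr i => (j != i) && a j
             end].

Lemma lit_val_lshift a i : lit_val a (lshift n i) = a i.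
Proof. by rewrite /lit_val (unsplitK (inl i)). Qed.

Lemma lit_val_rshift a i : lit_val a (rshift n i) = ~~ a i.
Proof. by rewrite /lit_val (unsplitK (inr i)). Qed.

Lemma lit_neg_lshift i : lit_neg (lshift n i) = rshift n i.
Proof. by rewrite /lit_neg (unsplitK (inl i)). Qed.

Lemma lit_neg_rshift i : lit_neg (rshift n i) = lshift n i.
Proof. by rewrite /lit_neg (unsplitK (inr i)). Qed.

Lemma litP v : (exists i, v = lshift n i) \/ (exists i, v = rshift n i).
Proof. by rewrite -[v]splitK; case: (split v) => i; [left|right]; exists i. Qed.

Lemma lit_negK : involutive lit_neg.
Proof.
by move=> v; case: (litP v) => -[i ->]; rewrite ?(lit_neg_lshift, lit_neg_rshift).
Qed.

Lemma lit_val_neg a v : lit_val a (lit_neg v) = ~~ lit_val a v.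
Proof.
by case: (litP v) => -[i ->];
  rewrite ?(lit_neg_lshift, lit_neg_rshift, lit_val_lshift, lit_val_rshift) ?negbK.
Qed.

Lemma assign_id v a : lit_val a v -> assign v a = a.
Proof.
move=> av; apply/ffunP => j; rewrite ffunE; move: av; rewrite /lit_val.
by case: (split v) => i av; case: eqP => //= ->; rewrite ?av // (negbTE av).
Qed.

Lemma lit_val_assign v a u :
  lit_val (assign v a) u = (u == v) || ((u != lit_neg v) && lit_val a u).
Proof.
case: (litP v) => -[i ->]; case: (litP u) => -[j ->];
  rewrite ?(lit_neg_lshift, lit_neg_rshift) ?(lit_val_lshift, lit_val_rshift) ?ffunE
    ?(unsplitK (inl i)) ?(unsplitK (inr i))
    ?eq_lshift ?eq_rshift ?eq_lrshift ?eq_rlshift //=.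
- by rewrite negb_or.
- by rewrite negb_and negbK.
Qed.

Lemma mon_assign v A a :
  mon A (assign v a) = (lit_neg v \notin A) && mon (A :\ v) a.
Proof.
have nvv : lit_neg v != v.
  by apply/eqP => /(congr1 (lit_val a)); rewrite lit_val_neg; case: lit_val.
apply/forallP/andP => [H|[nA /forallP H] u].
  split.
    by apply/negP => vA; have:= implyP (H _) vA; rewrite lit_val_assign eqxx (negbTE nvv).
  apply/forallP => u; apply/implyP; rewrite !inE => /andP[uv uA].
  by have := implyP (H u) uA; rewrite lit_val_assign (negbTE uv) => /andP[].
apply/implyP => uA; rewrite lit_val_assign; case: eqVneq => //= uv.
have := H u; rewrite !inE uv uA /= => ->; rewrite andbT.
by apply: contraNneq nA => <-.
Qed.

Lemma monU A B a : mon (A :|: B) a = mon A a && mon B a.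
Proof.
apply/forallP/andP => [H|[/forallP HA /forallP HB] u].
  by split; apply/forallP => u; apply/implyP => uA; apply: (implyP (H u));
    rewrite inE uA ?orbT.
by apply/implyP; rewrite inE => /orP[] uA;
  [apply: implyP (HA u) _|apply: implyP (HB u) _].
Qed.

Lemma mon0 a : mon set0 a.
Proof. by apply/forallP => u; rewrite inE. Qed.

Lemma mon1 v a : mon [set v] a = lit_val a v.
Proof.
apply/forallP/idP => [/(_ v)|av u]; first by rewrite inE eqxx.
by apply/implyP; rewrite inE => /eqP ->.
Qed.

End Literals.

(** Serves to factor a monomial into two halves when completing the square. *)
Lemma setU_split (T : finType) (A : {set T}) (d e : nat) : (#|A| <= d + e)%N ->
  exists B C : {set T}, [/\ A = B :|: C, (#|B| <= d)%N & (#|C| <= e)%N].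
Proof.
move=> cA; exists [set x in take d (enum A)], [set x in drop d (enum A)]; split.
- by apply/setP => x; rewrite !inE -mem_cat cat_take_drop mem_enum.
- by rewrite cardsE (leq_trans (card_size _)) // size_take_min geq_minl.
- by rewrite cardsE (leq_trans (card_size _)) // size_drop -cardE; lia.
Qed.

(** * Spans of monomials and the degree of functions *)

Definition card_le (T : finType) (d : nat) : pred {set T} := fun A => (#|A| <= d)%N.

Section Span.
Variables (R : realType) (n : nat).
Implicit Types (P : pred {set 'I_(n + n)}) (F G : cube n -> R).

(** [P] is an arbitrary set of monomials, since the descent allows all thin monomials together with
    a finite set of wide ones. *)
Inductive in_span P : (cube n -> R) -> Prop :=
| span_mon c A : P A -> in_span P (fun a => c * (mon A a)%:R)
| span_zero : in_span P (fun=> 0)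
| span_add F G : in_span P F -> in_span P G -> in_span P (fun a => F a + G a)
| span_ext F G : F =1 G -> in_span P F -> in_span P G.

Lemma span_mono P P' F : {subset P <= P'} -> in_span P F -> in_span P' F.
Proof.
move=> sPP; elim=> {F} [c A PA| |F G _ hF _ hG|F G eFG _ hF].
- by apply: span_mon; apply: sPP.
- exact: span_zero.
- exact: span_add.
- exact: span_ext eFG hF.
Qed.

Lemma span_scale P c F : in_span P F -> in_span P (fun a => c * F a).
Proof.
elim=> {F} [d A PA| |F G _ hF _ hG|F G eFG _ hF].
- by apply: span_ext (span_mon (c * d) PA) => a; rewrite mulrA.
- by apply: span_ext (span_zero P) => a; rewrite mulr0.
- by apply: span_ext (span_add hF hG) => a; rewrite mulrDr.
- by apply: span_ext hF => a; rewrite eFG.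
Qed.

Lemma span_sum (I : Type) (r : seq I) (Q : pred I) P (F : I -> cube n -> R) :
  (forall i, Q i -> in_span P (F i)) -> in_span P (fun a => \sum_(i <- r | Q i) F i a).
Proof.
move=> hF; elim: r => [|i r IH].
  by apply: span_ext (span_zero P) => a; rewrite big_nil.
case Qi: (Q i).
  by apply: span_ext (span_add (hF i Qi) IH) => a; rewrite big_cons Qi.
by apply: span_ext IH => a; rewrite big_cons Qi.
Qed.

Lemma span_assign P P' v F :
    (forall A, P A -> lit_neg v \notin A -> P' (A :\ v)) ->
  in_span P F -> in_span P' (fun a => F (assign v a)).
Proof.
move=> hP; elim=> {F} [c A PA| |F G _ hF _ hG|F G eFG _ hF].
- case: (boolP (lit_neg v \in A)) => vA.
    by apply: span_ext (span_zero P') => a; rewrite mon_assign vA mulr0.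
  by apply: span_ext (span_mon c (hP _ PA vA)) => a; rewrite mon_assign vA.
- exact: span_zero.
- exact: span_add.
- by apply: span_ext hF => a.
Qed.

End Span.

Notation deg_le d := (in_span (@card_le _ d)).

Section Degree.
Variables (R : realType) (n : nat).
Implicit Types (F G : cube n -> R).

Lemma deg_le_mono d e F : (d <= e)%N -> deg_le d F -> deg_le e F.
Proof. by move=> de; apply: span_mono => A /leq_trans; apply. Qed.

Lemma deg_le_mul d e F G : deg_le d F -> deg_le e G ->
  deg_le (d + e) (fun a => F a * G a).
Proof.
move=> hF hG; elim: hF => {F} [c A cA| |F F' _ hF _ hF'|F F' eF _ hF].
- elim: hG => {G} [c' B cB| |G G' _ hG _ hG'|G G' eG _ hG].
  + have cAB : card_le (d + e) (A :|: B).
      by apply: leq_trans (leq_card_setU _ _) _; apply: leq_add.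
    by apply: span_ext (span_mon (c * c') cAB) => a; rewrite monU -mulnb natrM; ring.
  + by apply: span_ext (span_zero _ _) => a; rewrite mulr0.
  + by apply: span_ext (span_add hG hG') => a; rewrite mulrDr.
  + by apply: span_ext hG => a; rewrite eG.
- by apply: span_ext (span_zero _ _) => a; rewrite mul0r.
- by apply: span_ext (span_add hF hF') => a; rewrite mulrDl.
- by apply: span_ext hF => a; rewrite eF.
Qed.

Lemma deg_le_const (c : R) : deg_le 0 (fun _ : cube n => c).
Proof.
have c0 : card_le 0 (set0 : {set 'I_(n + n)}) by rewrite /card_le cards0.
by apply: span_ext (span_mon c c0) => a; rewrite mon0 mulr1.
Qed.

Lemma deg_le_lit v : deg_le 1 (fun a : cube n => (lit_val a v)%:R : R).
Proof.
have c1 : card_le 1 [set v] by rewrite /card_le cards1.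
by apply: span_ext (span_mon (1 : R) c1) => a; rewrite mon1 mul1r.
Qed.

Lemma deg_le_prod (I : finType) (J : {set I}) k (F : I -> cube n -> R) :
  (forall i, deg_le k (F i)) -> deg_le (k * #|J|) (fun a => \prod_(i in J) F i a).
Proof.
move=> hF; rewrite -sum1_card big_distrr /= muln1.
elim: (index_enum I) => [|i r IH].
  by rewrite big_nil; apply: span_ext (deg_le_const 1) => a; rewrite big_nil.
rewrite big_cons; case: ifP => iJ.
  by apply: span_ext (deg_le_mul (hF i) IH) => a; rewrite big_cons iJ.
by apply: span_ext IH => a; rewrite big_cons iJ.
Qed.

Lemma deg_le_assign d v F : deg_le d F -> deg_le d (fun a => F (assign v a)).
Proof.
apply: span_assign => A cA _; apply: leq_trans cA.
by apply: subset_leq_card; rewrite subD1set.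
Qed.

End Degree.

(** * Derivations over functions on the cube and their restrictions *)

Section Derivations.
Variables (R : realType) (n l m w : nat).
Implicit Types (P : pred {set 'I_(n + n)}) (F G : cube n -> R).
Implicit Types (q : 'I_l -> cube n -> R) (p : 'I_m -> cube n -> R).

(* Positivstellensatz proofs modulo the Boolean axioms; P0, P1 and P2 are the
   monomials allowed in r_{i,emptyset}, r_{i,J} and t_j. *)
Inductive derives P0 P1 P2 q p : (cube n -> R) -> Prop :=
| derives_zero : derives P0 P1 P2 q p (fun=> 0)
| derives_add F G : derives P0 P1 P2 q p F -> derives P0 P1 P2 q p G ->
    derives P0 P1 P2 q p (fun a => F a + G a)
| derives_sq r : in_span P0 r -> derives P0 P1 P2 q p (fun a => r a ^+ 2)
| derives_prod (J : {set 'I_l}) r : (0 < #|J| <= w)%N -> in_span P1 r ->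
    derives P0 P1 P2 q p (fun a => r a ^+ 2 * \prod_(j in J) q j a)
| derives_eq j t : in_span P2 t -> derives P0 P1 P2 q p (fun a => t a * p j a)
| derives_ext F G : F =1 G -> derives P0 P1 P2 q p F -> derives P0 P1 P2 q p G.

Lemma derives_sum (I : Type) (r : seq I) (Q : pred I) P0 P1 P2 q p
    (F : I -> cube n -> R) :
    (forall i, Q i -> derives P0 P1 P2 q p (F i)) ->
  derives P0 P1 P2 q p (fun a => \sum_(i <- r | Q i) F i a).
Proof.
move=> hF; elim: r => [|i r IH].
  by apply: derives_ext (derives_zero _ _ _ _ _) => a; rewrite big_nil.
case Qi: (Q i).
  by apply: derives_ext (derives_add (hF i Qi) IH) => a; rewrite big_cons Qi.
by apply: derives_ext IH => a; rewrite big_cons Qi.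
Qed.

Lemma derives_mono P0 P1 P2 (P0' P1' P2' : pred {set 'I_(n + n)}) q p F :
    {subset P0 <= P0'} -> {subset P1 <= P1'} -> {subset P2 <= P2'} ->
  derives P0 P1 P2 q p F -> derives P0' P1' P2' q p F.
Proof.
move=> s0 s1 s2; elim=> {F} [|F G _ hF _ hG|r hr|J r hJ hr|j t ht|F G eFG _ hF].
- exact: derives_zero.
- exact: derives_add.
- by apply: derives_sq; apply: span_mono hr.
- by apply: derives_prod => //; apply: span_mono hr.
- by apply: derives_eq; apply: span_mono ht.
- exact: derives_ext eFG hF.
Qed.

Lemma derives_scale c P0 P1 P2 q p F : 0 <= c ->
  derives P0 P1 P2 q p F -> derives P0 P1 P2 q p (fun a => c * F a).
Proof.
move=> c0; elim=> {F} [|F G _ hF _ hG|r hr|J r hJ hr|j t ht|F G eFG _ hF].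
- by apply: derives_ext (derives_zero _ _ _ _ _) => a; rewrite mulr0.
- by apply: derives_ext (derives_add hF hG) => a; rewrite mulrDr.
- apply: derives_ext (derives_sq _ _ _ _ (span_scale (Num.sqrt c) hr)) => a.
  by rewrite exprMn sqr_sqrtr.
- apply: derives_ext (derives_prod _ _ _ _ hJ (span_scale (Num.sqrt c) hr)) => a.
  by rewrite exprMn sqr_sqrtr ?mulrA.
- by apply: derives_ext (derives_eq _ _ _ _ _ (span_scale c ht)) => a; rewrite mulrA.
- by apply: derives_ext hF => a; rewrite eFG.
Qed.

(** Substitution commutes with sums and products, so every rule is preserved; only the monomials not
    killed by the assignment have to be allowed afterwards. *)
Lemma derives_assign P0 P1 P2 (P0' P1' P2' : pred {set 'I_(n + n)}) q p v F :
    (forall A, P0 A -> lit_neg v \notin A -> P0' (A :\ v)) ->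
    (forall A, P1 A -> lit_neg v \notin A -> P1' (A :\ v)) ->
    (forall A, P2 A -> lit_neg v \notin A -> P2' (A :\ v)) ->
  derives P0 P1 P2 q p F ->
  derives P0' P1' P2' (fun j a => q j (assign v a)) (fun j a => p j (assign v a))
    (fun a => F (assign v a)).
Proof.
move=> s0 s1 s2; elim=> {F} [|F G _ hF _ hG|r hr|J r hJ hr|j t ht|F G eFG _ hF].
- exact: derives_zero.
- exact: derives_add hF hG.
- exact: derives_sq (span_assign s0 hr).
- exact: (derives_prod _ _ (fun j a => q j (assign v a)) _ hJ (span_assign s1 hr)).
- exact: (derives_eq _ _ _ (fun j a => p j (assign v a)) j (span_assign s2 ht)).
- by apply: derives_ext hF => a.
Qed.

End Derivations.

(** * Lifting refutations from restricted to unrestricted constraints *)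

Section Unrestricting.
Variables (R : realType) (n l m w k h : nat).
Hypotheses (w_gt0 : (0 < w)%N) (kw_lt2h : (k * w < h.*2)%N).
Implicit Types (F G : cube n -> R).
Implicit Types (q : 'I_l -> cube n -> R) (p : 'I_m -> cube n -> R).

(* The extra h is room in s_emptyset for the degree of products of at most w
   constraints; keeping it apart from e makes the bound survive restrictions,
   which may lower the degrees of the q_j. *)
Definition derives_deg e q p F :=
  derives w (@card_le _ (e + h)) (@card_le _ e) (@card_le _ e.*2) q p F.

(** For a literal y one has y r^2 = (y r)^2, and a constraint agrees with its restriction wherever y
    = 1, so y times one is y times the other. The factor y costs one unit of half-degree. *)
Lemma derives_mul_lit e q p v F :
    derives_deg e (fun j a => q j (assign v a)) (fun j a => p j (assign v a)) F ->
  derives_deg e.+1 q p (fun a => (lit_val a v)%:R * F a).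
Proof.
elim=> {F} [|F G _ hF _ hG|r hr|J r hJ hr|j t ht|F G eFG _ hF].
- by apply: derives_ext (derives_zero _ _ _ _ _ _) => a; rewrite mulr0.
- by apply: derives_ext (derives_add hF hG) => a; rewrite mulrDr.
- have hv := deg_le_mul (deg_le_lit R v) hr.
  by apply: derives_ext (derives_sq _ _ _ _ _ hv) => a;
    case: lit_val; rewrite ?mul1r ?mul0r ?expr0n.
- have hv := deg_le_mul (deg_le_lit R v) hr.
  apply: derives_ext (derives_prod _ _ _ _ hJ hv) => a.
  by case: (boolP (lit_val a v)) => [/assign_id ->|_]; rewrite ?mul1r ?mul0r ?expr0n /= ?mul0r.
- have hv : deg_le e.+1.*2 (fun a => (lit_val a v)%:R * t a).
    by apply: deg_le_mono (deg_le_mul (deg_le_lit R v) ht); lia.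
  apply: derives_ext (derives_eq _ _ _ _ _ j hv) => a.
  by case: (boolP (lit_val a v)) => [/assign_id ->|_]; rewrite ?mul1r ?mul0r.
- by apply: derives_ext hF => a; rewrite eFG.
Qed.

Lemma derives_const e q p c : 0 <= c -> derives_deg e q p (fun=> c).
Proof.
move=> c0.
have h1 : deg_le (e + h) (fun _ : cube n => Num.sqrt c).
  by apply: deg_le_mono (deg_le_const n _).
by apply: derives_ext (derives_sq _ _ _ _ _ h1) => a; rewrite sqr_sqrtr.
Qed.

(* Completing the square: for 0/1-valued x, y, z and d^2 = eps, r = c/(2d),
   eps + c y x z = (d x + r y z)^2 + eps (1 - x) + r^2 (y - y z) - r^2 y,
   where 1 - x and y - y z are their own squares. *)
Lemma derives_perturb e q p v G :
    derives_deg e q p (fun a => - (lit_val a v)%:R) ->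
    deg_le (e.*2 + k * w) G ->
  forall eps, 0 < eps -> derives_deg e q p (fun a => eps + (lit_val a v)%:R * G a).
Proof.
move=> hv; elim=> {G} [c A cA| |F G _ hF _ hG|F G eFG _ hF] eps eps0.
(* As k w < 2h, the monomial has degree at most 2(e + h) - 1; the second factor is left one short to
   make room for the literal. *)
- have [|B [C [-> cB cC]]] := @setU_split _ A (e + h) (e + h).-1.
    by apply: leq_trans cA _; lia.
  pose d := Num.sqrt eps; have d0 : 0 < d by rewrite sqrtr_gt0.
  have d2 : d ^+ 2 = eps by rewrite sqr_sqrtr // ltW.
  (* This is r in the identity above, whose x, y, z are [mon B], [lit_val a v], [mon C]. *)
  pose x := c / (2 * d).
  have hB : deg_le (e + h) (fun a => (mon B a)%:R : R).
    by apply: span_ext (span_mon (1 : R) cB) => a; rewrite mul1r.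
  have hv1 := deg_le_lit R v.
  have hC : deg_le (e + h) (fun a => (lit_val a v)%:R * (mon C a)%:R : R).
    have hC1 := span_mon (P := @card_le _ (e + h).-1) (1 : R) cC.
    apply: span_ext (deg_le_mono _ (deg_le_mul hv1 hC1)) => [a|]; first by rewrite mul1r.
    by rewrite /=; lia.
  have h1 := span_add (span_scale d hB) (span_scale x hC).
  have h2 : deg_le (e + h) (fun a => 1 + (-1) * (mon B a)%:R : R).
    by apply: span_add (span_scale _ hB); apply: deg_le_mono (deg_le_const n _).
  have h3 : deg_le (e + h)
      (fun a => (lit_val a v)%:R + (-1) * ((lit_val a v)%:R * (mon C a)%:R) : R).
    by apply: span_add (span_scale _ hC); apply: deg_le_mono hv1; lia.
  have D1 : derives_deg e q p _ := derives_sq w _ _ q p h1.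
  have D2 : derives_deg e q p _ := derives_scale (ltW eps0) (derives_sq w _ _ q p h2).
  have D3 : derives_deg e q p _ := derives_scale (sqr_ge0 x) (derives_sq w _ _ q p h3).
  have D4 := derives_scale (sqr_ge0 x) hv.
  apply: derives_ext (derives_add (derives_add D1 D2) (derives_add D3 D4)) => a.
  rewrite monU -d2.
  have cE : c = 2 * d * x by rewrite /x; field; rewrite gt_eqF.
  rewrite cE; case: (mon B a); case: (mon C a); case: (lit_val a v) => /=; ring.
- by apply: derives_ext (derives_const _ _ _ (ltW eps0)) => a; rewrite mulr0 addr0.
- have e2 : 0 < eps / 2 by lra.
  by apply: derives_ext (derives_add (hF _ e2) (hG _ e2)) => a; field.
- by apply: derives_ext (hF _ eps0) => a; rewrite eFG.
Qed.

(** Replacing a constraint g by its restriction in a term f g adds a function that vanishes where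
    [v] holds. It is thus a multiple of [lit_neg v], and [derives_perturb] absorbs it at the cost of
    an arbitrarily small constant, with [e] unchanged. *)
Lemma derives_unassign e q p v F :
    (forall j, deg_le k (q j)) -> (forall j, deg_le k (p j)) ->
    derives_deg e q p (fun a => - (lit_val a (lit_neg v))%:R) ->
    derives_deg e (fun j a => q j (assign v a)) (fun j a => p j (assign v a)) F ->
  forall eps, 0 < eps -> derives_deg e q p (fun a => eps + F a).
Proof.
move=> hq hp hv.
have D f g eps : 0 < eps ->
    deg_le (e.*2 + k * w) (fun a => f a * (g (assign v a) - g a)) ->
    derives_deg e q p (fun a => f a * g a) ->
    derives_deg e q p (fun a => eps + f a * g (assign v a)).
  move=> eps0 hy hf.
  apply: derives_ext (derives_add hf (derives_perturb hv hy eps0)) => a.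
  by rewrite lit_val_neg; case: (boolP (lit_val a v)) => [/assign_id ->|_] /=; ring.
elim=> {F} [|F G _ hF _ hG|r hr|J r hJ hr|j t ht|F G eFG _ hF] eps eps0.
- by apply: derives_ext (derives_const _ _ _ (ltW eps0)) => a; rewrite addr0.
- have e2 : 0 < eps / 2 by lra.
  by apply: derives_ext (derives_add (hF _ e2) (hG _ e2)) => a; field.
- exact: derives_add (derives_const _ _ _ (ltW eps0)) (derives_sq _ _ _ _ _ hr).
- have hJw : (k * #|J| <= k * w)%N.
    by rewrite leq_mul2l; case/andP: hJ => _ ->; rewrite orbT.
  have hQ := deg_le_mono hJw (deg_le_prod J hq).
  have hdiff := deg_le_mul (deg_le_mul hr hr)
    (span_add (deg_le_assign v hQ) (span_scale (-1) hQ)).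
  apply: D (derives_prod _ _ _ _ hJ hr) => //; rewrite -addnn.
  by apply: span_ext hdiff => a; ring.
(* Positivity of [w] gives k <= k w, so equations fit the same degree bound as products. *)
- have hP : deg_le (k * w) (p j) by apply: deg_le_mono (hp j); rewrite leq_pmulr.
  have hdiff := deg_le_mul ht (span_add (deg_le_assign v hP) (span_scale (-1) hP)).
  apply: D (derives_eq _ _ _ _ _ j ht) => //.
  by apply: span_ext hdiff => a; ring.
- by apply: derives_ext (hF _ eps0) => a; rewrite eFG.
Qed.

(** Branching on a literal: only the branch [v] = 0 has to be cheaper by one; it yields -
    [lit_neg v] >= 0, with which the other branch is lifted. *)
Lemma refute_unassign e q p v :
    (forall j, deg_le k (q j)) -> (forall j, deg_le k (p j)) ->
    derives_deg e (fun j a => q j (assign (lit_neg v) a))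
      (fun j a => p j (assign (lit_neg v) a)) (fun=> -1) ->
    derives_deg e.+1 (fun j a => q j (assign v a))
      (fun j a => p j (assign v a)) (fun=> -1) ->
  derives_deg e.+1 q p (fun=> -1).
Proof.
move=> hq hp hN hv.
have D : derives_deg e.+1 q p (fun a => - (lit_val a (lit_neg v))%:R).
  by apply: derives_ext (derives_mul_lit hN) => a; rewrite mulrN1.
(* With eps = 1/2 the lifted refutation derives -1/2, which is then doubled. *)
have e2 : 0 < (2^-1 : R) by rewrite invr_gt0.
apply: derives_ext (derives_scale (ler0n R 2) (derives_unassign hq hp D hv e2)) => a.
by field.
Qed.

End Unrestricting.

(** * Killing the wide monomials one literal at a time *)

Section Descent.
Variables (R : realType) (n l m w k h d : nat).
Hypotheses (w_gt0 : (0 < w)%N) (kw_lt2h : (k * w < h.*2)%N) (d_gt0 : (0 < d)%N).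
Implicit Types (v : 'I_(n + n)) (A : {set 'I_(n + n)}) (M : {set {set 'I_(n + n)}}).

(** Assignments only shrink monomials, so thin ones stay thin and need no bookkeeping; [M] holds the
    wide ones that may still occur. *)
Definition thin_or_in M : pred {set 'I_(n + n)} := fun A => (#|A| < d)%N || (A \in M).

(* Only the monomials that are still wide after the assignment are kept. *)
Definition assign_wide v M : {set {set 'I_(n + n)}} :=
  [set A :\ v | A in [set A in M | (lit_neg v \notin A) && (d <= #|A :\ v|)%N]].

Lemma thin_or_in_assign v M A : thin_or_in M A -> lit_neg v \notin A ->
  thin_or_in (assign_wide v M) (A :\ v).
Proof.
rewrite /thin_or_in => hA nA; case: ltnP => //= dA; apply: imset_f.
rewrite inE nA dA; case/orP: hA => [|-> //].
by rewrite ltnNge (leq_trans dA) // subset_leq_card // subD1set.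
Qed.

Lemma card_assign_wide v M :
  (#|assign_wide v M| <= #|[set A in M | lit_neg v \notin A]|)%N.
Proof.
apply: leq_trans (leq_imset_card _ _) _; apply: subset_leq_card.
by apply/subsetP => A; rewrite !inE => /and3P[-> ->].
Qed.

(** After the assignment neither [v] nor [lit_neg v] occurs in a kept monomial. The number of
    occurring literals serves as induction measure because the branch [v] = 1 need not reduce the
    number of wide monomials. *)
Lemma cover_assign_wide v M u : u \in cover M -> u = v \/ u = lit_neg v ->
  (#|cover (assign_wide v M)| < #|cover M|)%N.
Proof.
move=> uM uv; apply: proper_card; apply/properP; split.
  apply/subsetP => x /bigcupP[_ /imsetP[A + ->]]; rewrite !inE => /andP[AM _].
  by case/andP=> _ xA; apply/bigcupP; exists A.
exists u => //; apply/bigcupP => -[_ /imsetP[A + ->]]; rewrite !inE => /and3P[_ nA _].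
by case: uv => ->; rewrite ?eqxx // (negbTE nA) andbF.
Qed.

(** Averaging: the 2n literals have at least d |M| occurrences in total. With n + 1 in place of n,
    weak inequalities already give the contradiction and n = 0 is no special case. *)
Lemma frequent_literal M : {in M, forall A, (d <= #|A|)%N} -> M != set0 ->
  exists v, (d * #|M| <= #|[set A in M | v \in A]| * (n + 1).*2)%N.
Proof.
move=> wide M0; apply/existsP; apply: contraT; rewrite negb_exists => /forallP few.
have Mgt0 : (0 < d * #|M|)%N by rewrite muln_gt0 d_gt0 card_gt0.
(* Double counting of the pairs of a monomial in [M] and a literal in it. *)
have le1 : (d * #|M| <= \sum_v #|[set A in M | v \in A]|)%N.
  rewrite mulnC -sum_nat_const; apply: leq_trans (leq_sum _ wide) _.
  under eq_bigr do rewrite -sum1_card.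
  rewrite (exchange_big_dep predT) //=; apply: leq_sum => v _.
  by rewrite sum1dep_card.
have le2 : (\sum_v #|[set A in M | v \in A]| * (n + 1).*2 <= (n + n) * (d * #|M|))%N.
  apply: leq_trans (leq_sum (E2 := fun=> (d * #|M|)%N) _ _) _ => [v _|].
    by have := few v; rewrite -ltnNge => /ltnW.
  by rewrite sum_nat_const card_ord.
rewrite -big_distrl /= in le2.
have := leq_trans (leq_mul le1 (leqnn (n + 1).*2)) le2.
by rewrite mulnC leq_pmul2r //; lia.
Qed.

(* exp(-d/2(n+1)) bounds the fraction 1 - d/2(n+1) of the wide monomials that
   survives the killing of a frequent literal, so b such steps suffice. *)
Lemma low_degree_refutation b M (q : 'I_l -> cube n -> R) (p : 'I_m -> cube n -> R) :
    {in M, forall A, (d <= #|A|)%N} ->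
    (forall j, deg_le k (q j)) -> (forall j, deg_le k (p j)) ->
    #|M|%:R * expR (- (d%:R / (n + 1).*2%:R)) ^+ b < 1 :> R ->
    derives w (thin_or_in M) (thin_or_in M) (thin_or_in M) q p (fun=> -1) ->
  derives_deg w h (d.-1 + b) q p (fun=> -1).
Proof.
set E := expR _.
have E0 : 0 < E by exact: expR_gt0.
have E1 : 1 - d%:R / (n + 1).*2%:R <= E by exact: expR_ge1Dx.
(* The measure drops in both branches, while |M| E^b stays below 1. *)
have [N ltN] := ubnP #|cover M|; elim: N => // N IH in b M q p ltN *.
move=> wide hq hp small hM.
have [M0|Mn0] := eqVneq M set0.
  by move: hM; rewrite M0; apply: derives_mono => A;
    rewrite unfold_in /thin_or_in in_set0 orbF unfold_in /card_le; lia.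
have [v hv] := frequent_literal wide Mn0.
have Mgt0 : (0 < #|M|)%N by rewrite card_gt0.
have vM : v \in cover M.
  have: (0 < #|[set A in M | v \in A]|)%N by nia.
  by case/card_gt0P => A; rewrite inE => /andP[AM vA]; apply/bigcupP; exists A.
have wideA u : {in assign_wide u M, forall A, (d <= #|A|)%N}.
  by move=> _ /imsetP[A + ->]; rewrite inE => /and3P[].
have hMA u := derives_assign (@thin_or_in_assign u M) (@thin_or_in_assign u M)
  (@thin_or_in_assign u M) hM.
have hqA u j := deg_le_assign u (hq j).
have hpA u j := deg_le_assign u (hp j).
case: b small => [|b] small.
  by move: small; rewrite expr0 mulr1 ltrn1 ltnNge Mgt0.
rewrite addnS; apply: (refute_unassign w_gt0 kw_lt2h hq hp (v := v)).
(* Branch [v] = 0: all monomials containing [v] die, which pays for lowering [b] by one. *)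
- apply: (IH _ (assign_wide (lit_neg v) M)) => //.
    by apply: leq_trans (cover_assign_wide vM _) _ => //; right; rewrite lit_negK.
  apply: le_lt_trans small; rewrite exprS mulrA ler_wpM2r ?exprn_ge0 ?(ltW E0) //.
  apply: (@le_trans _ _ (#|M|%:R * (1 - d%:R / (n + 1).*2%:R))); last first.
    by rewrite ler_wpM2l.
  have n0 : 0 < (n + 1).*2%:R :> R by rewrite ltr0n; lia.
  rewrite -(ler_pM2r n0) mulrBr mulr1 mulrBl -mulrA divfK ?gt_eqF //.
  rewrite lerBrDr -!natrM -natrD ler_nat.
  have := card_assign_wide (lit_neg v) M; rewrite lit_negK.
  have : (#|[set A in M | v \in A]| + #|[set A in M | v \notin A]| = #|M|)%N.
    rewrite -(cardsID [set A : {set 'I_(n + n)} | v \in A] M); congr (_ + _)%N.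
    by apply: eq_card => A; rewrite !inE andbC.
    by apply: eq_card => A; rewrite !inE andbC.
  nia.
(* Branch [v] = 1: [b] is kept, and it suffices that the number of wide monomials does not grow. *)
- rewrite -addnS; apply: (IH _ (assign_wide v M)) => //.
    by apply: leq_trans (cover_assign_wide vM _) _ => //; left.
  apply: le_lt_trans small; rewrite ler_wpM2r ?exprn_ge0 ?(ltW E0) // ler_nat.
  apply: leq_trans (card_assign_wide _ _) _; apply: subset_leq_card.
  by apply/subsetP => A; rewrite inE => /andP[].
Qed.

End Descent.

(** * Polynomials as functions on the cube, and the Boolean ideal *)

Section Polynomials.
Variables (R : realType) (n : nat).
Implicit Types (f g : twin_poly R n) (a : cube n).

Definition eval a f : R := meval (fun v => (lit_val a v)%:R) f.

Definition lits (x : multinom (n + n)) : {set 'I_(n + n)} := [set v | x v != 0%N].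

Lemma evalX a x : eval a (mpolyX R x) = (mon (lits x) a)%:R.
Proof.
rewrite /eval mevalX; case: (boolP (mon _ a)) => [/forallP H|].
  rewrite big1 // => v _; have := H v; rewrite inE.
  by case: eqP => [->|_] /=; [rewrite expr0 | move->; rewrite expr1n].
rewrite negb_forall => /existsP[v]; rewrite negb_imply inE => /andP[xv /negbTE av].
by rewrite (bigD1 v) //= av expr0n (negbTE xv) mul0r.
Qed.

Lemma evalE a f :
  eval a f = \sum_(x <- msupp f) mcoeff x f * (mon (lits x) a)%:R.
Proof.
rewrite /eval mevalE; apply: eq_bigr => x _; congr (_ * _).
by rewrite -evalX /eval mevalX.
Qed.

Lemma span_eval (P : pred {set 'I_(n + n)}) f :
    {in msupp f, forall x, P (lits x)} ->
  in_span P (fun a => eval a f).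
Proof.
move=> hP; apply: span_ext (span_sum (msupp f) _) => [a|x xf].
  by rewrite evalE big_seq.
exact: span_mon (hP x xf).
Qed.

Lemma card_lits x : (#|lits x| <= mdeg x)%N.
Proof.
rewrite mdegE -sum1_card big_mkcond /=; apply: leq_sum => v _.
by rewrite inE; case: (x v).
Qed.

Lemma deg_le_eval d f : (msize f <= d.+1)%N -> deg_le d (fun a => eval a f).
Proof.
move=> fd; apply: span_eval => x /msize_mdeg_lt xf.
by apply: leq_trans (card_lits x) _; rewrite -ltnS (leq_trans xf).
Qed.

Lemma deg_le_evalP d F : deg_le d F ->
  exists f, (msize f <= d.+1)%N /\ forall a, eval a f = F a.
Proof.
elim=> {F} [c A cA| |F G _ [f [fd fF]] _ [g [gd gG]]|F G eFG _ [f [fd fF]]].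
(* The multilinear monomial with support [A]. *)
- pose x := Multinom [tuple nat_of_bool (v \in A) | v < n + n].
  have xE v : x v = (v \in A) by rewrite multinomE tnth_map tnth_ord_tuple.
  have xA : lits x = A by apply/setP => v; rewrite inE xE; case: (v \in A).
  exists (c *: mpolyX R x); split.
    apply: leq_trans (msizeZ_le _ _) _; rewrite msizeX ltnS mdegE.
    apply: leq_trans cA; rewrite -sum1_card [leqRHS]big_mkcond leq_sum // => v _.
    by rewrite xE /=; case: (v \in A).
  by move=> a; rewrite /eval mevalZ -/(eval _ _) evalX xA.
- by exists 0; rewrite msize0; split=> // a; rewrite /eval meval0.
- exists (f + g); split.
    by apply: leq_trans (msizeD_le _ _) _; rewrite geq_max fd gd.
  by move=> a; rewrite /eval mevalD -!/(eval _ _) fF gG.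
- by exists f; split=> // a; rewrite fF.
Qed.

Definition in_bool_ideal f : Prop :=
  exists u : 'I_n + 'I_n + 'I_n -> twin_poly R n, f = \sum_b u b * bool_axiom R b.

Lemma ideal_axiom b : in_bool_ideal (bool_axiom R b).
Proof.
exists (fun c => (c == b)%:R); rewrite (bigD1 b) //= eqxx mul1r big1 ?addr0 //.
by move=> c /negbTE ->; rewrite mul0r.
Qed.

Lemma idealM f g : in_bool_ideal f -> in_bool_ideal (g * f).
Proof.
case=> u ->; exists (fun b => g * u b); rewrite big_distrr /=.
by apply: eq_bigr => b _; rewrite mulrA.
Qed.

Lemma idealD f g : in_bool_ideal f -> in_bool_ideal g -> in_bool_ideal (f + g).
Proof.
move=> [u ->] [u' ->]; exists (fun b => u b + u' b); rewrite -big_split /=.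
by apply: eq_bigr => b _; rewrite mulrDl.
Qed.

Lemma ideal0 : in_bool_ideal 0.
Proof. by exists (fun=> 0); rewrite big1 // => b _; rewrite mul0r. Qed.

Lemma idealB f g : in_bool_ideal f -> in_bool_ideal g -> in_bool_ideal (f - g).
Proof. by move=> hf hg; rewrite -mulN1r; apply: idealD hf (idealM _ hg). Qed.

Lemma eval_bool_axiom a b : eval a (bool_axiom R b) = 0.
Proof.
case: b => [[i|i]|i]; rewrite /eval /bool_axiom /var /twin ?mevalB ?mevalD ?meval1
  ?expr2 ?mevalM ?mevalXU ?lit_val_lshift ?lit_val_rshift;
  by case: (a i) => /=; ring.
Qed.

Definition lit_poly (i : 'I_n) (b : bool) : twin_poly R n :=
  if b then var R i else twin R i.

(** The Lagrange basis of the cube: the value is 1 at [a] and 0 at every other point. *)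
Definition point_poly a : twin_poly R n := \prod_i lit_poly i (a i).

(** The product contains x or its twin x'. The cases reduce to x (x - 1), an axiom, and x x' = x' (x
    + x' - 1) - (x'^2 - x'), up to exchanging x and x'. *)
Lemma ideal_var_point a v :
  in_bool_ideal ((mpolyX R (mnm1 v) - ((lit_val a v)%:R)%:A) * point_poly a).
Proof.
have point_factor i : exists g, point_poly a = lit_poly i (a i) * g.
  by rewrite /point_poly (bigD1 i) //=; eexists.
have A1 i := ideal_axiom (inl (inl i)).
have A2 i := ideal_axiom (inl (inr i)).
have A3 i := ideal_axiom (inr i).
case: (litP v) => -[i ->]; rewrite ?lit_val_lshift ?lit_val_rshift;
  have [g ->] := point_factor i; case: (a i) => /=; rewrite ?scale1r ?scale0r.
- rewrite [X in in_bool_ideal X](_ : _ = g * bool_axiom R (inl (inl i))); first exact: idealM.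
  by rewrite /= /var; ring.
- rewrite [X in in_bool_ideal X](_ : _ =
    g * (twin R i * bool_axiom R (inr i) - bool_axiom R (inl (inr i)))).
    by apply: idealM; apply: idealB => //; apply: idealM.
  by rewrite /= /var /twin; ring.
- rewrite [X in in_bool_ideal X](_ : _ =
    g * (var R i * bool_axiom R (inr i) - bool_axiom R (inl (inl i)))).
    by apply: idealM; apply: idealB => //; apply: idealM.
  by rewrite /= /var /twin; ring.
- rewrite [X in in_bool_ideal X](_ : _ = g * bool_axiom R (inl (inr i))); first exact: idealM.
  by rewrite /= /twin; ring.
Qed.

(** The property [K] below is compatible with products and linear combinations, so it passes from
    the variables to all polynomials. *)
Lemma ideal_eval_point a f : in_bool_ideal ((f - (eval a f)%:A) * point_poly a).
Proof.
pose K f c := in_bool_ideal ((f - c%:A) * point_poly a).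
have KM f1 c1 f2 c2 : K f1 c1 -> K f2 c2 -> K (f1 * f2) (c1 * c2).
  move=> h1 h2; rewrite /K.
  rewrite (_ : _ * point_poly a = f2 * ((f1 - c1%:A) * point_poly a)
    + c1%:A * ((f2 - c2%:A) * point_poly a)); first by apply: idealD; apply: idealM.
  by rewrite -!mul_mpolyC !mulr1 mpolyCM; ring.
have K1 : K 1 1 by rewrite /K scale1r subrr mul0r; apply: ideal0.
have KX x : K (mpolyX R x) (eval a (mpolyX R x)).
  rewrite /eval mevalX mpolyXE_id; apply: (big_ind2 K K1 KM) => v _.
  by elim: (x v) => [|e IH]; rewrite ?expr0 ?exprS //;
    apply: KM => //; apply: ideal_var_point.
elim/mpolyind: f => [|c x f _ _ IH].
  by rewrite /eval meval0 scale0r subrr mul0r; apply: ideal0.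
rewrite (_ : _ * _ = c%:A * ((mpolyX R x - (eval a (mpolyX R x))%:A) * point_poly a)
    + (f - (eval a f)%:A) * point_poly a).
  by apply: idealD => //; apply: idealM; apply: KX.
rewrite /eval mevalD mevalZ -!/(eval _ _).
by rewrite -!mul_mpolyC !mulr1 mpolyCD mpolyCM; ring.
Qed.

(** The sum is the expansion of the product of all x_i plus twin, and each such factor is 1 modulo
    the ideal. *)
Lemma ideal_sum_point : in_bool_ideal (1 - \sum_a point_poly a).
Proof.
rewrite /point_poly -(bigA_distr_bigA lit_poly).
apply: (big_ind (fun g => in_bool_ideal (1 - g))) => [|f g hf hg|i _].
- by rewrite subrr; apply: ideal0.
- rewrite (_ : 1 - f * g = g * (1 - f) + (1 - g)); last by ring.
  by apply: idealD => //; apply: idealM.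
- rewrite big_bool (_ : 1 - _ = -1 * bool_axiom R (inr i)); last by rewrite /=; ring.
  by apply: idealM; apply: ideal_axiom.
Qed.

(* Interpolation: f = \sum_a f point_poly a modulo the ideal, and each
   f point_poly a is f(a) point_poly a. *)
Lemma ideal_vanishing f : (forall a, eval a f = 0) -> in_bool_ideal f.
Proof.
move=> f0.
rewrite (_ : f = f * (1 - \sum_a point_poly a) + \sum_a f * point_poly a).
  apply: idealD; first exact: idealM ideal_sum_point.
  apply: (big_ind in_bool_ideal) => [|g g'|a _]; [exact: ideal0|exact: idealD|].
  by have := ideal_eval_point a f; rewrite f0 scale0r subr0.
by rewrite -big_distrr /=; ring.
Qed.

End Polynomials.

(** * From derivations back to polynomials *)

Section Realization.
Variables (R : realType) (n l m w h e : nat).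
Variables (q : 'I_l -> twin_poly R n) (p : 'I_m -> twin_poly R n).

(** Collects a derivation into the data of a proof, with equality at the points of the cube only.
    Every nonempty J of size at most [w] is listed; idle ones carry an empty sum of squares. *)
Lemma derives_polys F :
    derives_deg w h e (fun j a => eval a (q j)) (fun j a => eval a (p j)) F ->
  exists (r : {set 'I_l} -> seq (twin_poly R n)) (t : 'I_m -> twin_poly R n),
    [/\ forall f, f \in r set0 -> (msize f <= (e + h).+1)%N,
        forall J f, J != set0 -> f \in r J -> (msize f <= e.+1)%N,
        forall j, (msize (t j) <= e.*2.+1)%N
      & forall a, F a = eval a (sum_sq (r set0)
          + \sum_(J in [set J : {set 'I_l} | (0 < #|J| <= w)%N])
              sum_sq (r J) * \prod_(j in J) q j
          + \sum_(j < m) t j * p j)].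
Proof.
elim=> {F} [|F G _ [r [t [r0 r1 t0 rtF]]] _ [r' [t' [r0' r1' t0' rtG]]]
  |f /deg_le_evalP[g [gd gf]]|J f hJ /deg_le_evalP[g [gd gf]]
  |j f /deg_le_evalP[g [gd gf]]|F G eFG _ [r [t [r0 r1 t0 rtF]]]].
- exists (fun=> [::]), (fun=> 0); split=> // [j|a]; first by rewrite msize0.
  rewrite [X in eval _ (X + _)](_ : _ = 0) ?[X in eval _ (_ + X)](_ : _ = 0).
  + by rewrite addr0 /eval meval0.
  + by rewrite big1 // => j _; rewrite mul0r.
  + rewrite /sum_sq big_nil add0r big1 // => J _.
    by rewrite mul0r.
- exists (fun J => r J ++ r' J), (fun j => t j + t' j); split.
  + by move=> f; rewrite mem_cat => /orP[/r0|/r0'].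
  + by move=> J f J0; rewrite mem_cat => /orP[]; [apply: r1|apply: r1'].
  + by move=> j; apply: leq_trans (msizeD_le _ _) _; rewrite geq_max t0 t0'.
  + move=> a; rewrite rtF rtG -[RHS]/(meval _ _) -mevalD; congr meval.
    rewrite /sum_sq big_cat /=.
    under [X in _ = _ + X + _]eq_bigr do rewrite big_cat mulrDl.
    under [X in _ = _ + X]eq_bigr do rewrite mulrDl.
    by rewrite !big_split /=; ring.
- exists (fun J => if J == set0 then [:: g] else [::]), (fun=> 0); split=> [f'|J f'|j|a].
  + by rewrite eqxx inE => /eqP ->.
  + by move/negbTE ->.
  + by rewrite msize0.
  rewrite eqxx big1 => [|J]; last first.
    by rewrite inE card_gt0 => /andP[/negbTE -> _]; rewrite /sum_sq big_nil mul0r.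
  rewrite big1 => [|j _]; last by rewrite mul0r.
  by rewrite !addr0 /sum_sq big_seq1 -gf !expr2 /eval mevalM.
- have J0 : J != set0 by move: hJ; rewrite card_gt0 => /andP[].
  exists (fun J' => if J' == J then [:: g] else [::]), (fun=> 0); split=> [f'|J' f' _|j|a].
  + by rewrite eq_sym (negbTE J0).
  + by case: eqP => // _; rewrite inE => /eqP ->.
  + by rewrite msize0.
  rewrite eq_sym (negbTE J0) (bigD1 J) ?inE //= eqxx.
  rewrite [X in _ + (_ + X)]big1 => [|J' /andP[_ /negbTE ->]]; last first.
    by rewrite /sum_sq big_nil mul0r.
  rewrite [X in _ + X]big1 => [|j _]; last by rewrite mul0r.
  rewrite /sum_sq big_nil big_seq1 !addr0 add0r -gf !expr2 /eval !mevalM.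
  by congr (_ * _); rewrite (rmorph_prod (meval _)).
- exists (fun=> [::]), (fun i => if i == j then g else 0); split=> // [i|a].
  + by case: eqP => // _; rewrite msize0.
  rewrite big1 => [|J _]; last by rewrite /sum_sq big_nil mul0r.
  rewrite (bigD1 j) //= eqxx big1 => [|i /negbTE ->]; last by rewrite mul0r.
  by rewrite /sum_sq big_nil !add0r addr0 -gf /eval mevalM.
- by exists r, t; split=> // a; rewrite -eFG.
Qed.

(** [msize] is the degree plus one, and 0 for the zero polynomial, which matches degree -oo. *)
Lemma deg_leE N (f : mpoly N R) d : (deg f <= d%:R%:E)%E = (msize f <= d.+1)%N.
Proof.
rewrite /deg; case: eqP => [->|/eqP f0]; first by rewrite msize0 leNye.
by rewrite lee_fin ler_nat -ltnS prednK // lt0n msize_poly_eq0.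
Qed.

Lemma msize_sum_sq N (r : seq (mpoly N R)) d :
  (forall f, f \in r -> (msize f <= d.+1)%N) -> (msize (sum_sq r) <= d.*2.+1)%N.
Proof.
move=> hr; rewrite /sum_sq big_seq; apply: leq_trans (msize_sum _ _ _) _.
apply/bigmax_leqP_seq => f _ fr; rewrite expr2.
have [->|f0] := eqVneq f 0; first by rewrite mul0r msize0.
by rewrite msizeM //; move: (hr f fr); move: (msize f) => x; lia.
Qed.

End Realization.

(** * Translating refutations to derivations and back *)

Section Refutations.
Variables (R : realType) (n k l m w : nat).
Variables (q : 'I_l -> twin_poly R n) (p : 'I_m -> twin_poly R n).

(** Evaluation on the cube erases the multiples of the Boolean axioms; [M] consists of the supports
    with at least [d] literals among the terms that count towards size. *)
Lemma ps_refutation_derives d s (pi : ps_refutation q p) :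
    ps_width_le pi w -> (ps_size pi <= s)%N ->
  exists M : {set {set 'I_(n + n)}},
    [/\ {in M, forall A : {set 'I_(n + n)}, (d <= #|A|)%N}, (#|M| <= s)%N
      & derives w (thin_or_in d M) (thin_or_in d M) (thin_or_in d M)
          (fun j a => eval a (q j)) (fun j a => eval a (p j)) (fun=> -1)].
Proof.
move=> width size_s.
pose polys := ps_sos pi set0 ++ flatten [seq ps_sos pi J | J <- enum (ps_sets pi)]
  ++ [seq ps_eqs pi j | j <- enum 'I_m].
pose L := flatten [seq [seq lits x | x <- msupp f] | f <- polys].
pose M := [set A in L | (d <= #|A|)%N].
have hspan f : f \in polys -> in_span (thin_or_in d M) (fun a => eval a f).
  move=> fp; apply: span_eval => x xf; rewrite /thin_or_in inE.
  case: ltnP => //= _; rewrite andbT; apply/flattenP.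
  by exists [seq lits x | x <- msupp f]; apply: map_f.
exists M; split.
- by move=> A; rewrite inE => /andP[].
- apply: leq_trans size_s; apply: leq_trans (_ : size L <= _)%N.
    apply: leq_trans (card_size L); apply: subset_leq_card.
    by apply/subsetP => A; rewrite inE => /andP[].
  rewrite /ps_size /L size_flatten /shape -map_comp sumnE big_map.
  rewrite !big_cat /= big_flatten /= !big_map !big_enum /= addnA.
  rewrite leq_add // ?leq_add //.
  + by apply: leq_sum => f _; rewrite /= size_map.
  + by apply: leq_sum => J _; apply: leq_sum => f _; rewrite /= size_map.
  + by apply: leq_sum => j _; rewrite /= size_map.
pose DD := derives w (thin_or_in d M) (thin_or_in d M) (thin_or_in d M)
  (fun j a => eval a (q j)) (fun j a => eval a (p j)).
have D0 : DD (fun a => \sum_(f <- ps_sos pi set0) eval a f ^+ 2).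
  apply: derives_ext (derives_sum (ps_sos pi set0) (Q := fun f => f \in ps_sos pi set0) _)
    => [a|f fr].
    by rewrite -big_seq.
  by apply: derives_sq; apply: hspan; rewrite mem_cat fr.
have D1 : DD (fun a => \sum_(J in ps_sets pi)
    (\sum_(f <- ps_sos pi J) eval a f ^+ 2) * \prod_(j in J) eval a (q j)).
  apply: derives_sum => J JS.
  have hJ : (0 < #|J| <= w)%N.
    rewrite width // andbT card_gt0; apply: contraTneq JS => ->.
    exact: ps_sets_nonempty.
  apply: derives_ext (derives_sum (ps_sos pi J) (Q := fun f => f \in ps_sos pi J) _)
    => [a|f fr].
    by rewrite -big_seq big_distrl.
  apply: derives_prod => //; apply: hspan.
  rewrite !mem_cat; apply/orP; right; apply/orP; left.
  by apply/flattenP; exists (ps_sos pi J) => //; rewrite map_f ?mem_enum.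
have D2 : DD (fun a => \sum_(j < m) eval a (ps_eqs pi j) * eval a (p j)).
  apply: derives_sum => j _; apply: derives_eq; apply: hspan.
  by rewrite !mem_cat map_f ?mem_enum ?orbT.
apply: derives_ext (derives_add (derives_add D0 D1) D2) => a /=.
have evalD f g : eval a (f + g) = eval a f + eval a g by exact: mevalD.
have evalM f g : eval a (f * g) = eval a f * eval a g by exact: mevalM.
have eval_sum I (r : seq I) Q (f : I -> twin_poly R n) :
    eval a (\sum_(i <- r | Q i) f i) = \sum_(i <- r | Q i) eval a (f i).
  exact: (raddf_sum (meval _)).
have -> : -1 = eval a (-1 : twin_poly R n) by rewrite /eval mevalN meval1.
rewrite (congr1 (eval a) (ps_identity pi)) !evalD !eval_sum.
rewrite [X in _ = _ + X]big1 ?addr0; last first.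
  by move=> b _; rewrite evalM eval_bool_axiom mulr0.
congr (_ + _ + _).
- by apply: eq_bigr => f _; rewrite !expr2 evalM.
- apply: eq_bigr => J _; rewrite evalM eval_sum; congr (_ * _).
    by apply: eq_bigr => f _; rewrite !expr2 evalM.
  by rewrite /eval (rmorph_prod (meval _)).
- by apply: eq_bigr => j _; rewrite evalM.
Qed.

(** The defect of the identity vanishes on the cube, so it lies in the Boolean ideal, which supplies
    the u_q. Degrees are at most 2(e + h) for the empty set and 2e + k w < 2(e + h) elsewhere. *)
Lemma derives_ps_refutation h e (D : R) :
    (forall j, (deg (q j) <= k%:R%:E)%E) -> (forall j, (deg (p j) <= k%:R%:E)%E) ->
    (0 < w)%N -> (k * w < h.*2)%N -> (e + h).*2%:R <= D ->
    derives_deg w h e (fun j a => eval a (q j)) (fun j a => eval a (p j)) (fun=> -1) ->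
  exists pi : ps_refutation q p, ps_width_le pi w /\ ps_degree_le pi D.
Proof.
move=> hq hp w0 kw hD /derives_polys[r [t [r0 r1 t0 rtF]]].
set S := [set J : {set 'I_l} | (0 < #|J| <= w)%N] in rtF.
pose rhs := sum_sq (r set0) + \sum_(J in S) sum_sq (r J) * \prod_(j in J) q j
  + \sum_(j < m) t j * p j.
have [u hu] : in_bool_ideal (-1 - rhs).
  by apply: ideal_vanishing => a;
    rewrite [LHS]mevalB -[X in _ - X]/(eval a rhs) -rtF mevalN meval1 subrr.
have S0 : set0 \notin S by rewrite inE cards0.
have hid : -1 = rhs + \sum_b u b * bool_axiom R b by rewrite -hu addrC subrK.
have leD (f : twin_poly R n) c :
    (c <= (e + h).*2)%N -> (deg f <= c%:R%:E)%E -> (deg f <= D%:E)%E.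
  move=> hc /le_trans; apply; rewrite lee_fin; apply: le_trans hD.
  by rewrite ler_nat.
exists (PSProof S0 hid); split; first by move=> J /=; rewrite inE => /andP[].
split=> /= [||J JS|j].
- by apply: (@leD _ 0%N) => //; rewrite deg_leE msizeN msize1.
- by apply: (@leD _ (e + h).*2) => //; rewrite deg_leE; apply: msize_sum_sq.
- have [J0 Jw] : J != set0 /\ (#|J| <= w)%N.
    by move: JS; rewrite inE card_gt0 => /andP[].
  have h1 : (deg (sum_sq (r J)) <= e.*2%:R%:E)%E.
    by rewrite deg_leE; apply: msize_sum_sq => f; apply: r1.
  have h2 : (\sum_(j in J) deg (q j) <= (k * #|J|)%:R%:E)%E.
    apply: le_trans (lee_sum _ (fun j _ => hq j)) _.
    by rewrite sumEFin lee_fin sumr_const -mulrnA.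
  apply: le_trans (leeD h1 h2) _; rewrite -EFinD lee_fin -natrD.
  apply: le_trans hD; rewrite ler_nat doubleD leq_add2l.
  by apply: leq_trans (ltnW kw); rewrite leq_mul2l Jw orbT.
- have h1 : (deg (t j) <= e.*2%:R%:E)%E by rewrite deg_leE.
  apply: le_trans (leeD h1 (hp j)) _; rewrite -EFinD lee_fin -natrD.
  apply: le_trans hD; rewrite ler_nat doubleD leq_add2l.
  by apply: leq_trans (ltnW kw); rewrite leq_pmulr.
Qed.

End Refutations.

(** * Choice of the parameters *)

Theorem theorem1 (R : realType) (n k l m : nat)
    (q : 'I_l -> twin_poly R n) (p : 'I_m -> twin_poly R n)
    (hq : forall j : 'I_l, (deg (q j) <= k%:R%:E)%E)
    (hp : forall j : 'I_m, (deg (p j) <= k%:R%:E)%E)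
    (s w : nat) (hs : (0 < s)%N) (hw : (0 < w)%N) :
  (exists pi : ps_refutation q p, ps_width_le pi w /\ (ps_size pi <= s)%N) ->
  exists pi : ps_refutation q p,
    ps_width_le pi w /\
    ps_degree_le pi
      (4 * Num.sqrt (2 * (n + 1)%:R * ln s%:R) + (k * w)%:R + 4).
Proof.
case=> pi [width size_s].
set X := Num.sqrt _.
have X0 : 0 <= X by exact: sqrtr_ge0.
have N0 : 0 < (n + 1).*2%:R :> R by rewrite ltr0n; lia.
have X2 : X ^+ 2 = (n + 1).*2%:R * ln s%:R.
  rewrite /X sqr_sqrtr; first by rewrite -mul2n natrM.
  by rewrite !mulr_ge0 // ln_ge0 // ler1n.
(* Both the width threshold and the number of killing steps are b + 1, the least integer above X;
   the half-degree is then b + (b + 1). *)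
pose b := Num.truncn X; have /andP[bX Xb] := truncn_itv X0; rewrite -/b in bX Xb.
have [M [wide cM hM]] := ps_refutation_derives b.+1 width size_s.
have kw : (k * w < ((k * w)./2.+1).*2)%N by lia.
apply: (derives_ps_refutation hq hp hw kw (e := (b.+1.-1 + b.+1)%N)).
  (* Here 2(e + h) = 4b + 2 floor(kw/2) + 4, where b <= X. *)
  have half_le : (k * w)./2.*2%:R <= (k * w)%:R :> R by rewrite ler_nat; lia.
  rewrite (_ : (_ + _).*2 = (b * 4 + (k * w)./2.*2 + 4)%N); last by lia.
  by move: half_le bX; rewrite !natrD natrM; lra.
apply: (low_degree_refutation hw kw (ltn0Sn b) (M := M)) => //.
- by move=> j; apply: deg_le_eval; rewrite -deg_leE.
- by move=> j; apply: deg_le_eval; rewrite -deg_leE.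
rewrite -expRM_natl.
have s0 : 0 < s%:R :> R by rewrite ltr0n.
(* After taking logarithms this is (b + 1)^2 > X^2 = 2(n + 1) log s. *)
apply: le_lt_trans (_ : s%:R * expR (b.+1%:R * - (b.+1%:R / (n + 1).*2%:R)) < 1).
  by rewrite ler_wpM2r ?expR_ge0 // ler_nat.
rewrite -[s%:R]lnK // -expRD -[ltRHS]expR0 ltr_expR mulrN subr_lt0 mulrA -expr2.
by rewrite ltr_pdivlMr // [ltLHS]mulrC -X2 ltr_pXn2r // ?nnegrE.
Qed.
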